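(* For any real numbers $\epsilon>0$, $0<p<1$ and $c>0$ there is $N=N(\epsilon,p,c)$ such that for every $n>N(\epsilon,p,c)$ there is an explicit construction of a two-write binary WOM code of length $n(1+o(1))$ (where $o(1)\to 0$ as $n\to\infty$ with $\epsilon,p,c$ fixed) whose rate is at least $H(p)+1-p-\epsilon$. Furthermore, the encoding functions can be computed in time $n^{c+1}\cdot \mathrm{poly}(c\log n)$ and decoding can be done in time $n\cdot \mathrm{poly}(c\log n)$. Both encoding and decoding can be done in logarithmic space.
   Context: All logarithms are base $2$, and $H(p)=-p\log p-(1-p)\log(1-p)$ is the binary entropy function. For two vectors $y,y'\in\{0,1\}^\ell$ we write $y'\le y$ if $y'_i\le y_i$ for every coordinate $i$. A two-write binary WOM (write-once-memory) code of length $\ell$ over finite message sets $\Omega_1,\Omega_2$ consists of two encoding functions $E_1:\Omega_1\to\{0,1\}^\ell$ and $E_2:E_1(\Omega_1)\times\Omega_2\to\{0,1\}^\ell$ and two decoding functions $D_1:E_1(\Omega_1)\to\Omega_1$ and $D_2:E_2(E_1(\Omega_1)\times\Omega_2)\to\Omega_2$ such that: (1) $D_1(E_1(x))=x$ for every $x\in\Omega_1$; (2) $E_1(x_1)\le E_2(E_1(x_1),x_2)$ for every $x_1\in\Omega_1$, $x_2\in\Omega_2$; (3) $D_2(E_2(E_1(x_1),x_2))=x_2$ for every $x_1\in\Omega_1$, $x_2\in\Omega_2$. The rate of the code is $(\log|\Omega_1|+\log|\Omega_2|)/\ell$. ''Explicit'' means that the encoding and decoding functions are computed by deterministic algorithms,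 uniform in $n$, with the stated resource bounds. It is implicitly assumed that the decoder knows whether a given memory word was written in the first or in the second round. *)

(* Defs.v *)
From HB Require Import structures.
From mathcomp Require Import all_boot all_order all_algebra.
From mathcomp Require Import finmap.
From mathcomp Require Import all_classical all_reals all_analysis.

Set Implicit Arguments.
Unset Strict Implicit.
Unset Printing Implicit Defensive.
Import Order.TTheory GRing.Theory Num.Theory.
Import numFieldNormedType.Exports.

Local Open Scope ring_scope.

Definition log2 (R : realType) (x : R) : R := ln x / ln 2.

Definition entropy (R : realType) (p : R) : R :=
  - p * log2 p - (1 - p) * log2 (1 - p).

Definition word (l : nat) := (l.-tuple bool : Type).

Definition word_le (l : nat) (y' y : word l) : bool :=
  [forall i, tnth y' i ==> tnth y i].

(* The functions with domain E1(O1), E1(O1) * O2 and E2(E1(O1) * O2) are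
   represented by total functions whose values outside these domains are
   unconstrained; totality of the decoders excludes empty message sets. *)
Record wom_code (l : nat) (O1 O2 : finType) := WomCode {
  E1 : O1 -> word l;
  E2 : word l -> O2 -> word l;
  D1 : word l -> O1;
  D2 : word l -> O2;
  womD1 : forall x1, D1 (E1 x1) = x1;
  womE2 : forall x1 x2, word_le (E1 x1) (E2 (E1 x1) x2);
  womD2 : forall x1 x2, D2 (E2 (E1 x1) x2) = x2 }.

Definition rate (R : realType) (l : nat) (O1 O2 : finType)
    (_ : wom_code l O1 O2) : R :=
  (log2 #|O1|%:R + log2 #|O2|%:R) / l%:R.

(* Random access machine with the logarithmic cost criterion, read-only
   random access inputs (bit strings numbered 0, 1, ...) and a write-only
   output to which bits are appended. *)

Definition bitlen (n : nat) : nat := up_log 2 n.+1.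

Inductive instr :=
  | IConst of nat & nat           (* IConst d k  : r_d := k                   *)
  | IAdd of nat & nat & nat       (* IAdd d a b  : r_d := r_a + r_b           *)
  | ISub of nat & nat & nat       (* ISub d a b  : r_d := max(r_a - r_b, 0)   *)
  | IHalf of nat & nat            (* IHalf d a   : r_d := floor(r_a / 2)      *)
  | ILoad of nat & nat            (* ILoad d a   : r_d := r_(r_a)             *)
  | IStore of nat & nat           (* IStore a b  : r_(r_a) := r_b             *)
  | IRead of nat & nat & nat      (* IRead j d a : r_d := bit r_a of input j  *)
  | ISize of nat & nat            (* ISize j d   : r_d := length of input j   *)
  | IWrite of nat.                (* IWrite a    : output the bit r_a != 0    *)

Inductive prog :=
  | Do of instr
  | Seq of prog & prog
  | If of nat & prog & prog    (* tests r_a != 0 *)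
  | While of nat & prog.       (* tests r_a != 0 *)

Definition regs := {fsfun nat -> nat with 0%N}.

Record config := Config { reg : regs; out : seq bool }.

Definition input (inp : seq (seq bool)) (j : nat) : seq bool := nth [::] inp j.

Definition set_reg (s : config) (d v : nat) : config :=
  Config [fsfun reg s with d |-> v] (out s).

Definition step (inp : seq (seq bool)) (i : instr) (s : config) : config :=
  let r := reg s in
  match i with
  | IConst d k => set_reg s d k
  | IAdd d a b => set_reg s d (r a + r b)%N
  | ISub d a b => set_reg s d (r a - r b)%N
  | IHalf d a => set_reg s d (r a)./2
  | ILoad d a => set_reg s d (r (r a))
  | IStore a b => set_reg s (r a) (r b)
  | IRead j d a => set_reg s d (nth false (input inp j) (r a))
  | ISize j d => set_reg s d (size (input inp j))
  | IWrite a => Config r (rcons (out s) (r a != 0)%N)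
  end.

Definition cost (inp : seq (seq bool)) (i : instr) (s : config) : nat :=
  let r := reg s in
  match i with
  | IConst d k => (1 + bitlen k)%N
  | IAdd d a b => (1 + bitlen (r a) + bitlen (r b))%N
  | ISub d a b => (1 + bitlen (r a) + bitlen (r b))%N
  | IHalf d a => (1 + bitlen (r a))%N
  | ILoad d a => (1 + bitlen (r a) + bitlen (r (r a)))%N
  | IStore a b => (1 + bitlen (r a) + bitlen (r b))%N
  | IRead j d a => (1 + bitlen (r a))%N
  | ISize j d => (1 + bitlen (size (input inp j)))%N
  | IWrite a => (1 + bitlen (r a))%N
  end.

(* Work space only: the inputs and the output are not counted. *)
Definition space (s : config) : nat :=
  (\sum_(k <- finsupp (reg s)) (bitlen k + bitlen (reg s k)))%N.

(* [exec inp P s s' t m]: started in s, P halts in s' after time t, and m is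
   the largest work space over all configurations visited. *)
Inductive exec (inp : seq (seq bool)) :
    prog -> config -> config -> nat -> nat -> Prop :=
  | ExecDo i s :
      exec inp (Do i) s (step inp i s) (cost inp i s)
        (maxn (space s) (space (step inp i s)))
  | ExecSeq P Q s s' s'' t t' m m' :
      exec inp P s s' t m -> exec inp Q s' s'' t' m' ->
      exec inp (Seq P Q) s s'' (t + t')%N (maxn m m')
  | ExecIf a P Q s s' t m :
      exec inp (if reg s a != 0%N then P else Q) s s' t m ->
      exec inp (If a P Q) s s' (1 + bitlen (reg s a) + t)%N m
  | ExecWhileEnd a P s :
      reg s a = 0%N -> exec inp (While a P) s s 1 (space s)
  | ExecWhileStep a P s s' s'' t t' m m' :
      reg s a != 0%N ->
      exec inp P s s' t m -> exec inp (While a P) s' s'' t' m' ->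
      exec inp (While a P) s s'' (1 + bitlen (reg s a) + t + t')%N (maxn m m').

(* Register 0 initially holds the parameter n, all other registers hold 0. *)
Definition start (n : nat) : config :=
  Config [fsfun [fsfun of _ => 0%N] with 0%N |-> n] [::].

Definition computes_within (R : realType) (P : prog) (n : nat)
    (inp : seq (seq bool)) (res : seq bool) (T S : R) : Prop :=
  exists s t m, [/\ exec inp P (start n) s t m, out s = res,
    t%:R <= T & m%:R <= S].

(* A message set with M elements is taken to be {0, ..., M - 1}; programs
   handle a message through its binary expansion, least significant bit first,
   on the least number of bits sufficient for all messages. *)
Definition msg_bits (M : nat) (x : 'I_M) : seq bool :=
  mkseq (fun i => odd (x %/ 2 ^ i)) (up_log 2 M).

(* Main.v *)
(* A code of constant block length l, depending on eps and p only, is repeated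
   n %/ l times; its encoders and decoders are finite tables hard-wired in the
   programs, so one pass with O(1) counters suffices.
   In a block, the first message selects a word of weight w ~ p l: the most
   likely weight of l independent bits of bias p has probability at least
   1 / (l + 1), whence log2 'C(l, w) >= l H(p) - O(log l). The second message is
   read off by a colouring f of {0,1}^l with 2^k2 colours, k2 = l - w - O(log l),
   such that every subcube {z | y <= z} above a word y used in the first round
   contains all colours; a random f has this property with positive
   probability. *)
Require Import Defs.
From mathcomp Require Import all_boot all_order all_algebra.
From mathcomp Require Import finmap.
From mathcomp Require Import all_classical all_reals all_analysis.
From mathcomp Require Import zify ring lra.
Import Order.TTheory GRing.Theory Num.Theory.
Import numFieldNormedType.Exports.
Set Implicit Arguments.
Unset Strict Implicit.
Unset Printing Implicit Defensive.

(** * Colourings by counting, and the code for one block *)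

Lemma card_avoiding (T U : finType) (A : {set T}) (m : U) :
  #|[set f : {ffun T -> U} | [forall x in A, f x != m]]| =
  (#|U|.-1 ^ #|A| * #|U| ^ (#|T| - #|A|))%N.
Proof.
pose F x : pred U := if x \in A then predC1 m else predT.
rewrite (_ : #|_| = #|family F|); last first.
  rewrite cardsE; apply: eq_card => f; rewrite !unfold_in /=.
  apply/forallP/forallP => h x; have := h x; rewrite /F; case: (x \in A) => //=.
rewrite card_family foldrE big_map big_enum /=.
rewrite (bigID (mem A)) /= -(cardC A) addKn.
congr (_ * _)%N.
  rewrite -prod_nat_const; apply: eq_bigr => x xA.
  by rewrite /F xA cardC1.
rewrite -prod_nat_const; apply: eq_bigr => x; rewrite /F => /negbTE ->.
by rewrite eq_cardT.
Qed.

(** Union bound: for each of the [#|I| * #|U|] pairs [(i, m)], at most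
    [#|U|.-1 ^ s * #|U| ^ (#|T| - s)] functions miss the value [m] on [S i]. By the last hypothesis
    these are together fewer than all [#|U| ^ #|T|] functions, so some function is bad for no
    pair. *)
Lemma covering_function (T U I : finType) (S : I -> {set T}) (s : nat) :
  (0 < s <= #|T|)%N -> (forall i, s <= #|S i|)%N ->
  (#|I| * #|U| * #|U|.-1 ^ s < #|U| ^ s)%N ->
  exists f : T -> U, forall i m, exists2 x, x \in S i & f x = m.
Proof.
move=> /andP[s_gt0 sT] Ss lt_s.
have U_gt0 : (0 < #|U|)%N.
  by case: (posnP #|U|) lt_s => // ->; rewrite exp0n.
pose bad (im : I * U) :=
  [set f : {ffun T -> U} | [forall x in S im.1, f x != im.2]].
have card_bad im : (#|bad im| <= #|U|.-1 ^ s * #|U| ^ (#|T| - s))%N.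
  rewrite card_avoiding.
  have ST : (#|S im.1| <= #|T|)%N := max_card _.
  (* The points of [S im.1] in excess of [s] are split off: each contributes a factor [#|U|.-1],
     bounded by [#|U|]. *)
  have -> : (#|T| - s = (#|S im.1| - s) + (#|T| - #|S im.1|))%N.
    by have := Ss im.1; lia.
  rewrite expnD mulnA leq_mul2r; apply/orP; right.
  rewrite -{1}(subnKC (Ss im.1)) expnD leq_mul2l; apply/orP; right.
  by case: (#|S im.1| - s)%N => // k; rewrite leq_exp2r // leq_pred.
pose B := (\bigcup_(im : I * U) bad im)%SET.
have ltB : (#|B| < #|{ffun T -> U}|)%N.
  apply: (@leq_ltn_trans (\sum_(im : I * U) #|U|.-1 ^ s * #|U| ^ (#|T| - s))).
    apply: (@leq_trans (\sum_(im : I * U) #|bad im|)%N); last exact: leq_sum.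
    rewrite /B; elim/big_rec2: _ => [|im k A _ le_k]; first by rewrite cards0.
    by apply: leq_trans (leq_card_setU _ _).1 _; rewrite leq_add2l.
  rewrite sum_nat_const card_prod card_ffun mulnA.
  by rewrite -{2}(subnKC sT) expnD ltn_pmul2r // expn_gt0 U_gt0.
have [f fB] : exists f, f \notin B.
  apply/existsP; rewrite -negb_forall; apply: contraTN ltB => /forallP BT.
  by rewrite -leqNgt; apply: subset_leq_card; apply/fintype.subsetP => f _.
exists f => i m.
have : f \notin bad (i, m).
  by apply: contra fB => fb; apply/bigcupP; exists (i, m).
rewrite finset.inE negb_forall => /existsP[x].
by rewrite negb_imply negbK => /andP[xS /eqP fx]; exists x.
Qed.

(** This is [(1 - 1/B)^B <= 1/2]. It follows from the first two terms of the binomial expansion of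
    [(b + 1)^k], taken at [k = b + 1 = B]. *)
Lemma bernoulli_pred_expn (B : nat) :
  (0 < B)%N -> (2 * B.-1 ^ B <= B ^ B)%N.
Proof.
case: B => // b _ /=.
have H k : (b ^ k + k * b ^ k.-1 <= b.+1 ^ k)%N.
  elim: k => [|k IHk]; first by [].
  rewrite [leqRHS]expnS.
  apply: leq_trans (leq_mul (leqnn b.+1) IHk).
  rewrite expnS /=; case: k {IHk} => [|k] /=; first by rewrite !expn0; lia.
  by rewrite expnS; nia.
by apply: leq_trans (H b.+1); rewrite /= expnS; nia.
Qed.

(** Distinct sets [B] disjoint from [A] give distinct words above the indicator of [A], namely the
    indicators of the unions of [A] and [B]. *)
Lemma card_word_above (l : nat) (A : {set 'I_l}) :
  (2 ^ (l - #|A|) <= #|[set z : word l | word_le [tuple i \in A | i < l] z]|)%N.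
Proof.
pose join (B : {set 'I_l}) : word l := [tuple (i \in A) || (i \in B) | i < l].
have -> : (l - #|A| = #|~: A|)%N by rewrite -[X in (X - _)%N]card_ord -(cardsC A) addKn.
rewrite -card_powerset -(@card_in_imset _ _ join); last first.
  move=> B B'; rewrite !powersetE => sB sB' eqB; apply/setP => i.
  have := congr1 (fun t => tnth t i) eqB; rewrite !tnth_mktuple.
  case: (boolP (i \in A)) => //= iA _.
  have := fintype.subsetP sB i; have := fintype.subsetP sB' i.
  rewrite finset.inE iA /=.
  by case: (i \in B) => [_ /(_ isT)|]; case: (i \in B') => // /(_ isT).
apply: subset_leq_card; apply/fintype.subsetP => _ /imsetP[B _ ->].
by rewrite finset.inE; apply/forallP => i; rewrite !tnth_mktuple; case: (i \in A).
Qed.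

(** The [u] bits given up pay for the union bound. When [k2 > 0], a subcube has at least
    [2^(l - w) = 2^k2 * 2^u] points, so a random colouring misses a given colour there with
    probability at most [2^-(2^u) <= 2^-(2l)], while there are only [2^(k1 + k2) < 2^(2l)] pairs of
    a first word and a colour. *)
Lemma block_code_exists (l w k1 u : nat) :
  (0 < l)%N -> (2 ^ k1 <= 'C(l, w))%N -> (2 * l <= 2 ^ u)%N ->
  inhabited (wom_code l (k1.-tuple bool) ((l - w - u).-tuple bool)).
Proof.
move=> l_gt0 k1_le le_u.
set k2 := (l - w - u)%N.
pose X := [set A : {set 'I_l} | #|A| == w].
have cardX : #|X| = 'C(l, w) by rewrite card_draws card_ord.
have cardk1 : (#|{: k1.-tuple bool}| <= #|X|)%N.
  by rewrite card_tuple card_bool cardX.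
pose supp (x : k1.-tuple bool) : {set 'I_l} :=
  enum_val (widen_ord cardk1 (enum_rank x)).
have supp_card x : #|supp x| = w.
  have := enum_valP (widen_ord cardk1 (enum_rank x)).
  by rewrite finset.inE => /eqP.
have supp_inj : injective supp.
  move=> x y /enum_val_inj /(congr1 val) /= /val_inj; exact: enum_rank_inj.
pose e1 (x : k1.-tuple bool) : word l := [tuple i \in supp x | i < l].
have e1_inj : injective e1.
  move=> x y eqxy; apply: supp_inj; apply/setP => i.
  by have := congr1 (fun t => tnth t i) eqxy; rewrite !tnth_mktuple.
pose S x := [set z : word l | word_le (e1 x) z].
have k1_le_l : (k1 <= l)%N.
  rewrite -(@leq_exp2l 2) //; apply: leq_trans k1_le _.
  rewrite -cardX; apply: leq_trans (max_card _) _.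
  by rewrite -cardsT -powersetT card_powerset cardsT card_ord.
have [|||f fP] := @covering_function (word l) (k2.-tuple bool) _ S (2 ^ (l - w)).
- by rewrite expn_gt0 /= card_tuple card_bool leq_exp2l // leq_subr.
- by move=> x; rewrite /S -(supp_card x); exact: card_word_above.
- rewrite !card_tuple !card_bool.
  (* Subtraction truncates, so [k2] may be 0. Then there is a single colour and the left side has a
     positive power of 0 as a factor. Otherwise [l - w = k2 + u] holds exactly. *)
  case: (posnP k2) => [->|k2_gt0].
    by rewrite expn0 /= exp0n ?expn_gt0 // muln0 exp1n.
  have -> : (l - w = k2 + u)%N by rewrite /k2; lia.
  set B := (2 ^ k2)%N.
  have B_gt1 : (1 < B)%N by rewrite /B -{1}(expn0 2) ltn_exp2l.
  have u_gt0 : (0 < u)%N by case: (u) le_u => //; lia.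
  rewrite expnD -/B !expnM.
  have H : (2 ^ (2 ^ u) * (B.-1 ^ B) ^ 2 ^ u <= (B ^ B) ^ 2 ^ u)%N.
    rewrite -expnMn leq_exp2r ?expn_gt0 //.
    by apply: bernoulli_pred_expn; exact: ltnW.
  apply: leq_trans H; rewrite ltn_pmul2r ?expn_gt0; last by lia.
  rewrite /B -expnD ltn_exp2l //; apply: leq_trans le_u.
  by move: k2_gt0; rewrite /k2; lia.
(* The defaults are reached only outside the image of [e1]: on it the colouring makes the search in
   [e2] succeed, and injectivity of [e1] makes the search in [d1] return the message. *)
pose d1 (y : word l) : k1.-tuple bool :=
  odflt [tuple of nseq k1 false] [pick x | e1 x == y].
pose e2 (y : word l) (x2 : k2.-tuple bool) : word l :=
  odflt y [pick z | word_le y z && (f z == x2)].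
have e2P x1 x2 : word_le (e1 x1) (e2 (e1 x1) x2) && (f (e2 (e1 x1) x2) == x2).
  rewrite /e2; case: pickP => //= none.
  have [z] := fP x1 x2; rewrite finset.inE => le_z fz.
  by have := none z; rewrite le_z fz eqxx.
split; apply: (@WomCode _ _ _ e1 e2 d1 f) => [x1|x1 x2|x1 x2].
- by rewrite /d1; case: pickP => [x /eqP/e1_inj//|/(_ x1)]; rewrite eqxx.
- by case/andP: (e2P x1 x2).
- by case/andP: (e2P x1 x2) => _ /eqP.
Qed.

(** * Bit strings cut into blocks *)

(** Positions past the end count as [false], the value that [IRead] returns there, so a segment is
    what a program reads even from a short or absent input. *)
Definition segment (b : nat) (s : seq bool) (i : nat) : seq bool :=
  mkseq (fun t => nth false s (i * b + t)) b.

Definition concat (b : nat) (G : nat -> seq bool) (q : nat) : seq bool :=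
  mkseq (fun t => nth false (G (t %/ b)) (t %% b)) (q * b).

Definition bits_tuple (b : nat) (s : seq bool) : b.-tuple bool :=
  [tuple nth false s i | i < b].

Lemma size_segment b s i : size (segment b s i) = b.
Proof. exact: size_mkseq. Qed.

Lemma size_concat b G q : size (concat b G q) = (q * b)%N.
Proof. exact: size_mkseq. Qed.

Lemma val_bits_tuple b s : size s = b -> bits_tuple b s = s :> seq bool.
Proof.
move=> sb; apply: (@eq_from_nth _ false); rewrite size_tuple // => i ib.
by rewrite -(tnth_nth _ _ (Ordinal ib)) tnth_mktuple.
Qed.

Lemma bits_tupleK b (t : b.-tuple bool) : bits_tuple b t = t.
Proof. exact: val_inj (val_bits_tuple (size_tuple t)). Qed.

Lemma nth_concat b G q i t : (i < q)%N -> (t < b)%N ->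
  nth false (concat b G q) (i * b + t) = nth false (G i) t.
Proof.
move=> iq tb; rewrite nth_mkseq; last by nia.
by rewrite divnMDl ?modnMDl ?(divn_small, modn_small) ?addn0 //; lia.
Qed.

Lemma segment_concat b G q i : (i < q)%N -> size (G i) = b ->
  segment b (concat b G q) i = G i.
Proof.
move=> iq sG; apply: (@eq_from_nth _ false); rewrite size_segment // => t tb.
by rewrite nth_mkseq // nth_concat.
Qed.

Lemma concat_segment b s q : size s = (q * b)%N -> concat b (segment b s) q = s.
Proof.
move=> sb; apply: (@eq_from_nth _ false); rewrite size_concat // => t tqb.
have b_gt0 : (0 < b)%N by case: (b) tqb => //; rewrite muln0.
by rewrite nth_mkseq // nth_mkseq ?ltn_mod // -divn_eq.
Qed.

Lemma eq_concat b G G' q : (forall i, (i < q)%N -> G i = G' i) ->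
  concat b G q = concat b G' q.
Proof.
move=> eqG; apply/eq_in_map => t; rewrite mem_iota add0n => /= tq.
by rewrite eqG // ltn_divLR //; case: (b) tq => //; rewrite muln0.
Qed.

Lemma concatS b G q : size (G q) = b -> concat b G q.+1 = concat b G q ++ G q.
Proof.
move=> sG; apply: (@eq_from_nth _ false) => [|t].
  by rewrite size_cat !size_concat sG mulSnr.
rewrite size_concat => tq; rewrite nth_cat size_concat; case: ltnP => tqb.
  by rewrite !nth_mkseq.
rewrite -{1}(subnKC tqb) nth_concat //; lia.
Qed.

Lemma word_le_concat b (G G' : nat -> seq bool) q :
  (forall i t, (i < q)%N -> (t < b)%N -> nth false (G i) t ==> nth false (G' i) t) ->
  word_le (bits_tuple (q * b) (concat b G q)) (bits_tuple (q * b) (concat b G' q)).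
Proof.
move=> le_G; apply/forallP => -[t tq]; rewrite !tnth_mktuple /= !nth_mkseq //.
have b_gt0 : (0 < b)%N by case: (b) tq => //; rewrite muln0.
by apply: le_G; rewrite ?ltn_mod // ltn_divLR.
Qed.

Fixpoint nat_of_bits (s : seq bool) : nat :=
  if s is b :: s' then (b + (nat_of_bits s').*2)%N else 0%N.

Lemma nat_of_bits_lt k (t : k.-tuple bool) : (nat_of_bits t < 2 ^ k)%N.
Proof.
rewrite -[X in (2 ^ X)%N](size_tuple t); elim: (tval t) => //= b s IHs.
by rewrite expnS; case: b; lia.
Qed.

Definition ord_of_bits (k : nat) (s : seq bool) : 'I_(2 ^ k) :=
  Ordinal (nat_of_bits_lt (bits_tuple k s)).

Lemma size_msg_bits k (x : 'I_(2 ^ k)) : size (msg_bits x) = k.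
Proof. by rewrite size_mkseq up_expnK. Qed.

Lemma nat_of_bits_mkseq k n : (n < 2 ^ k)%N ->
  nat_of_bits (mkseq (fun i => odd (n %/ 2 ^ i)) k) = n.
Proof.
elim: k n => [|k IHk] n; first by case: n.
rewrite expnS => n_lt; rewrite /mkseq /= divn1.
rewrite -[iota 1 k]/(iota (1 + 0) k) iotaDl -map_comp.
rewrite (eq_map (g := fun i => odd (n./2 %/ 2 ^ i))) => [|i]; last first.
  by rewrite /= expnS divnMA divn2.
by rewrite [nat_of_bits _]IHk ?odd_double_half //; lia.
Qed.

Lemma ord_of_bitsK k (x : 'I_(2 ^ k)) : ord_of_bits k (msg_bits x) = x.
Proof.
apply: val_inj; rewrite /= val_bits_tuple ?size_msg_bits // /msg_bits up_expnK //.
exact: nat_of_bits_mkseq.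
Qed.

(** * Repetition of the block code *)

Section RepeatedCode.

Variables (l k1 k2 q : nat) (C : wom_code l (k1.-tuple bool) (k2.-tuple bool)).

Definition block_E1 (u : seq bool) : seq bool := E1 C (bits_tuple k1 u).
Definition block_E2 (u v : seq bool) : seq bool :=
  E2 C (bits_tuple l u) (bits_tuple k2 v).
Definition block_D1 (u : seq bool) : seq bool := D1 C (bits_tuple l u).
Definition block_D2 (u : seq bool) : seq bool := D2 C (bits_tuple l u).

Definition seq_E1 (s : seq bool) :=
  concat l (fun i => block_E1 (segment k1 s i)) q.
Definition seq_E2 (s s' : seq bool) :=
  concat l (fun i => block_E2 (segment l s i) (segment k2 s' i)) q.
Definition seq_D1 (s : seq bool) :=
  concat k1 (fun i => block_D1 (segment l s i)) q.
Definition seq_D2 (s : seq bool) :=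
  concat k2 (fun i => block_D2 (segment l s i)) q.

Lemma seq_D1K s : size s = (q * k1)%N -> seq_D1 (seq_E1 s) = s.
Proof.
move=> sk; rewrite -[RHS](concat_segment sk); apply: eq_concat => i iq.
rewrite segment_concat ?size_tuple // /block_D1 bits_tupleK womD1.
by rewrite val_bits_tuple ?size_segment.
Qed.

Lemma segment_seq_E1 s i : (i < q)%N ->
  bits_tuple l (segment l (seq_E1 s) i) = E1 C (bits_tuple k1 (segment k1 s i)).
Proof.
by move=> iq; rewrite segment_concat ?size_tuple // bits_tupleK.
Qed.

Lemma seq_D2K s s' : size s' = (q * k2)%N -> seq_D2 (seq_E2 (seq_E1 s) s') = s'.
Proof.
move=> sk; rewrite -[RHS](concat_segment sk); apply: eq_concat => i iq.
rewrite segment_concat ?size_tuple // /block_D2 bits_tupleK segment_seq_E1 // womD2.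
by rewrite val_bits_tuple ?size_segment.
Qed.

(** Since the message sets have sizes that are powers of two, [msg_bits] uses exactly [q * k1] or
    [q * k2] bits, and every bit string of that length is a message. The definition is kept
    transparent for the two equations that follow. *)
Definition repeated_code : wom_code (q * l) 'I_(2 ^ (q * k1)) 'I_(2 ^ (q * k2)).
Proof.
apply: (@WomCode _ _ _
  (fun x1 => bits_tuple (q * l) (seq_E1 (msg_bits x1)))
  (fun y x2 => bits_tuple (q * l) (seq_E2 y (msg_bits x2)))
  (fun y => ord_of_bits (q * k1) (seq_D1 y))
  (fun y => ord_of_bits (q * k2) (seq_D2 y))) => [x1|x1 x2|x1 x2].
- rewrite val_bits_tuple ?size_concat // seq_D1K ?size_msg_bits //.
  exact: ord_of_bitsK.
- rewrite (val_bits_tuple (size_concat _ _ _)).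
  apply: word_le_concat => i t iq tl.
  rewrite /block_E2 segment_seq_E1 //.
  have /forallP/(_ (Ordinal tl)) := womE2 C (bits_tuple k1 (segment k1 (msg_bits x1) i))
    (bits_tuple k2 (segment k2 (msg_bits x2) i)).
  by rewrite !(tnth_nth false).
- rewrite (val_bits_tuple (size_concat _ _ _)) (val_bits_tuple (size_concat _ _ _)).
  by rewrite seq_D2K ?size_msg_bits // ord_of_bitsK.
Defined.

Lemma repeated_E1E x1 : E1 repeated_code x1 = seq_E1 (msg_bits x1) :> seq bool.
Proof. exact: val_bits_tuple (size_concat _ _ _). Qed.

Lemma repeated_E2E y x2 :
  E2 repeated_code y x2 = seq_E2 y (msg_bits x2) :> seq bool.
Proof. exact: val_bits_tuple (size_concat _ _ _). Qed.

End RepeatedCode.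

(** * Programs processing their inputs block by block *)

(* Registers beyond [size l] hold 0. *)
Definition represents (s : config) (l : seq nat) (o : seq bool) : Prop :=
  (forall k, reg s k = nth 0%N l k) /\ out s = o.

Definition bounded (V : nat) (l : seq nat) : bool :=
  (size l <= 7)%N && all (fun v => v <= V)%N l.

(* [T] counts instructions and tests; each costs at most [1 + 2 * bitlen V]. *)
Definition runs (inp : seq (seq bool)) (V : nat) (P : prog)
    (l : seq nat) (o : seq bool) (T : nat) (l' : seq nat) (o' : seq bool) : Prop :=
  forall s, represents s l o -> exists s' t m,
    [/\ exec inp P s s' t m, represents s' l' o',
        (t <= T * (1 + 2 * bitlen V))%N & (m <= 7 * (3 + bitlen V))%N].

Lemma leq_bitlen m n : (m <= n)%N -> (bitlen m <= bitlen n)%N.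
Proof. by move=> mn; apply: leq_up_log. Qed.

(** Only the addresses 0 to 6 can lie in the support. An address takes at most [bitlen 6 = 3] bits
    and its content at most [bitlen V]. *)
Lemma space_bounded s l o V : represents s l o -> bounded V l ->
  (Defs.space s <= 7 * (3 + bitlen V))%N.
Proof.
move=> [rs _] /andP[sl /allP lV]; rewrite /Defs.space.
have fin_lt k : k \in finsupp (reg s) -> (k < 7)%N.
  rewrite mem_finsupp rs; apply: contraNT; rewrite -leqNgt => k7.
  by rewrite nth_default // (leq_trans sl).
have le_sum (r : seq nat) : (forall k, k \in r -> k < 7)%N ->
    (\sum_(k <- r) (bitlen k + bitlen (reg s k)) <= size r * (3 + bitlen V))%N.
  elim: r => [|k r IHr] r7; first by rewrite big_nil.
  rewrite big_cons mulSn leq_add //; last first.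
    by apply: IHr => j jr; apply: r7; rewrite inE jr orbT.
  rewrite leq_add //.
    apply: (@leq_trans (bitlen 6)) => //; apply: leq_bitlen.
    by have := r7 k; rewrite inE eqxx => /(_ isT).
  apply: leq_bitlen; rewrite rs; case: (ltnP k (size l)) => kl.
    by apply: lV; exact: mem_nth.
  by rewrite nth_default.
apply: leq_trans (le_sum _ fin_lt) _; rewrite leq_mul2r; apply/orP; right.
rewrite -[leqRHS](size_iota 0); apply: uniq_leq_size => [|k]; first exact: fset_uniq.
by move=> /fin_lt; rewrite mem_iota.
Qed.

Lemma runs_do inp V i l o l' o' : bounded V l -> bounded V l' ->
  (forall s, represents s l o ->
     represents (step inp i s) l' o' /\ (cost inp i s <= 1 + 2 * bitlen V)%N) ->
  runs inp V (Do i) l o 1 l' o'.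
Proof.
move=> bl bl' H s rs; have [rs' le_c] := H s rs.
exists (step inp i s), (cost inp i s), (maxn (Defs.space s) (Defs.space (step inp i s))).
split=> //; first exact: ExecDo; first by rewrite mul1n.
by rewrite geq_max (space_bounded rs bl) (space_bounded rs' bl').
Qed.

Lemma represents_set_reg s l o d v : represents s l o ->
  represents (set_reg s d v) (set_nth 0%N l d v) o.
Proof.
move=> [rs os]; split=> //= k; rewrite fsfun_withE nth_set_nth /=.
by case: eqP => // _; exact: rs.
Qed.

Lemma bounded_nth V l k : bounded V l -> (nth 0%N l k <= V)%N.
Proof.
move=> /andP[_ /allP lV]; case: (ltnP k (size l)) => kl.
  by apply: lV; exact: mem_nth.
by rewrite nth_default.
Qed.

Lemma bitlen_represents s l o V k : represents s l o -> bounded V l ->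
  (bitlen (reg s k) <= bitlen V)%N.
Proof. by move=> [-> _] bl; exact/leq_bitlen/bounded_nth. Qed.

Section Instructions.

Variables (inp : seq (seq bool)) (V : nat) (l : seq nat) (o : seq bool).
Hypothesis bl : bounded V l.

Lemma runs_const d k : (k <= V)%N -> bounded V (set_nth 0%N l d k) ->
  runs inp V (Do (IConst d k)) l o 1 (set_nth 0%N l d k) o.
Proof.
move=> kV bl'; apply: runs_do => // s rs; split; first exact: represents_set_reg.
by rewrite /= leq_add2l (leq_trans (leq_bitlen kV)) ?leq_pmull.
Qed.

Lemma runs_add d a b (l' := set_nth 0%N l d (nth 0 l a + nth 0 l b)%N) :
  bounded V l' -> runs inp V (Do (IAdd d a b)) l o 1 l' o.
Proof.
move=> bl'; apply: runs_do => // s rs; split.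
  by rewrite /l' -!(proj1 rs); exact: represents_set_reg.
by have := bitlen_represents a rs bl; have := bitlen_represents b rs bl => /=; lia.
Qed.

Lemma runs_sub d a b (l' := set_nth 0%N l d (nth 0 l a - nth 0 l b)%N) :
  bounded V l' -> runs inp V (Do (ISub d a b)) l o 1 l' o.
Proof.
move=> bl'; apply: runs_do => // s rs; split.
  by rewrite /l' -!(proj1 rs); exact: represents_set_reg.
by have := bitlen_represents a rs bl; have := bitlen_represents b rs bl => /=; lia.
Qed.

Lemma runs_read j d a
    (l' := set_nth 0%N l d (nth false (input inp j) (nth 0 l a)%N)) :
  bounded V l' -> runs inp V (Do (IRead j d a)) l o 1 l' o.
Proof.
move=> bl'; apply: runs_do => // s rs; split.
  by rewrite /l' -!(proj1 rs); exact: represents_set_reg.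
by have := bitlen_represents a rs bl => /=; lia.
Qed.

Lemma runs_write a :
  runs inp V (Do (IWrite a)) l o 1 l (rcons o (nth 0 l a != 0)%N).
Proof.
apply: runs_do => // s rs; split; first by case: rs => rl ro; split=> //=; rewrite rl ro.
by have := bitlen_represents a rs bl => /=; lia.
Qed.

Lemma runs_seq P Q T T' l' o' l'' o'' :
  runs inp V P l o T l' o' -> runs inp V Q l' o' T' l'' o'' ->
  runs inp V (Seq P Q) l o (T + T') l'' o''.
Proof.
move=> HP HQ s /HP[s' [t [m [ex1 /HQ[s'' [t' [m' [ex2 rs'' tT' mV']]]] tT mV]]]].
exists s'', (t + t')%N, (maxn m m'); split=> //; first exact: ExecSeq ex1 ex2.
  by rewrite mulnDl leq_add.
by rewrite geq_max mV.
Qed.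

Lemma runs_if a P Q T l' o' :
  runs inp V (if nth 0 l a != 0 then P else Q)%N l o T l' o' ->
  runs inp V (If a P Q) l o T.+1 l' o'.
Proof.
move=> H s rs; have [s' [t [m [ex rs' tT mV]]]] := H s rs.
exists s', (1 + bitlen (reg s a) + t)%N, m; split=> //.
  by apply: ExecIf; rewrite (proj1 rs).
by rewrite mulSn leq_add // leq_add2l (leq_trans (bitlen_represents a rs bl)) ?leq_pmull.
Qed.

Lemma runs_while_end a P : nth 0%N l a = 0%N -> runs inp V (While a P) l o 1 l o.
Proof.
move=> la s rs; exists s, 1, (Defs.space s); split=> //.
- by apply: ExecWhileEnd; rewrite (proj1 rs).
- exact: space_bounded rs bl.
Qed.

Lemma runs_while_step a P T T' l' o' l'' o'' : nth 0%N l a != 0%N ->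
  runs inp V P l o T l' o' -> runs inp V (While a P) l' o' T' l'' o'' ->
  runs inp V (While a P) l o (T + T').+1 l'' o''.
Proof.
move=> la HP HQ s rs.
have [s' [t [m [ex1 rs' tT mV]]]] := HP s rs.
have [s'' [t' [m' [ex2 rs'' tT' mV']]]] := HQ s' rs'.
exists s'', (1 + bitlen (reg s a) + t + t')%N, (maxn m m'); split=> //.
- by apply: ExecWhileStep ex1 ex2; rewrite (proj1 rs).
- by have := bitlen_represents a rs bl; lia.
- by rewrite geq_max mV.
Qed.

End Instructions.

(* Register use: 0 remaining length, 1 loop test, 2 and 3 reading positions in
   the two inputs, 4 the constant 1, 5 the last bit read, 6 the constant l - 1,
   7 the constant 0. *)
Fixpoint read_block (j b : nat) (k : seq bool -> prog) (u : seq bool) : prog :=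
  if b is b'.+1 then
    Seq (Do (IRead j 5 (2 + j)))
      (Seq (Do (IAdd (2 + j) (2 + j) 4))
         (If 5 (read_block j b' k (rcons u true))
               (read_block j b' k (rcons u false))))
  else k u.

(** The final reset of register 5 erases the last bit read, so that all leaves of the decision tree
    end with the same register contents. *)
Fixpoint write_block (s : seq bool) : prog :=
  if s is b :: s' then Seq (Do (IWrite (if b then 4 else 7))) (write_block s')
  else Do (IConst 5 0).

(** Subtracting registers 6 and 4 lowers the remaining length by [l]. Truncated subtraction replaces
    a comparison: [n - (l - 1)] is nonzero exactly when [n >= l], so the test in register 1 says
    whether a full block remains. *)
Definition block_step (b0 b1 : nat) (F : seq bool -> seq bool -> seq bool) : prog :=
  Seq (read_block 0 b0 (fun u =>
         read_block 1 b1 (fun v => write_block (F u v)) [::]) [::])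
    (Seq (Do (ISub 0 0 6)) (Seq (Do (ISub 0 0 4)) (Do (ISub 1 0 6)))).

(* The output blocks [F u v] are hard-wired in the leaves of a decision tree
   that reads the bits of [u] and [v]. *)
Definition blockwise (l b0 b1 : nat) (F : seq bool -> seq bool -> seq bool) : prog :=
  Seq (Do (IConst 4 1)) (Seq (Do (IConst 6 l.-1)) (Seq (Do (ISub 1 0 6))
    (While 1 (block_step b0 b1 F)))).

(** * Correctness and cost of the block-by-block programs *)

Section Blockwise.

Variables (inp : seq (seq bool)) (V l : nat).
Hypotheses (V_gt0 : (0 < V)%N) (lV : (l.-1 <= V)%N).

Definition layout (n a p0 p1 x : nat) : seq nat := [:: n; a; p0; p1; 1%N; x; l.-1].

Lemma bounded_layout n a p0 p1 x :
  (n <= V)%N -> (a <= V)%N -> (p0 <= V)%N -> (p1 <= V)%N -> (x <= V)%N ->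
  bounded V (layout n a p0 p1 x).
Proof. by move=> nV aV p0V p1V xV; rewrite /bounded /= nV aV p0V p1V V_gt0 xV lV. Qed.

Lemma runs_write_block s n a p0 p1 x o : bounded V (layout n a p0 p1 x) ->
  runs inp V (write_block s) (layout n a p0 p1 x) o (size s).+1
    (layout n a p0 p1 0) (o ++ s).
Proof.
elim: s o => [|b s IHs] o bl /=.
  rewrite cats0; apply: runs_const => //.
  by move: bl; rewrite /bounded /=; lia.
rewrite -cat_rcons.
apply: (@runs_seq _ _ _ _ _ _ 1 (size s).+1 (layout n a p0 p1 x) (rcons o b));
  last exact: IHs.
by have := @runs_write inp V _ o bl (if b then 4 else 7)%N; case: b.
Qed.

(** The position [p] being advanced comes first whichever input it belongs to, so that one induction
    serves both inputs. *)
Definition reading (j : bool) (n a p p' x : nat) : seq nat :=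
  if j then layout n a p' p x else layout n a p p' x.

(** Each bit costs three steps: read, advance, test. The continuation must run correctly from every
    value [y] of register 5, which holds the last bit read. *)
Lemma runs_read_block (j : bool) b k u n a p p' x o T lf of_ :
  (n <= V)%N -> (a <= V)%N -> (p + b <= V)%N -> (p' <= V)%N -> (x <= V)%N ->
  (forall y, (y <= V)%N -> runs inp V
     (k (u ++ mkseq (fun t => nth false (input inp j) (p + t)) b))
     (reading j n a (p + b) p' y) o T lf of_) ->
  runs inp V (read_block j b k u) (reading j n a p p' x) o (b * 3 + T) lf of_.
Proof.
move=> nV aV + p'V; elim: b u p x => [|b IHb] u p x pV xV H.
  by have := H x xV; rewrite cats0 addn0.
have bl z y : (z <= V)%N -> (y <= V)%N -> bounded V (reading j n a z p' y).
  by move=> zV yV; rewrite /reading; case: (j); apply: bounded_layout.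
pose c := nth false (input inp j) p.
have cV : (c <= V)%N by case: (c).
have pV' : (p <= V)%N by lia.
have pV1 : (p + 1 <= V)%N by lia.
rewrite mulSn -!addnA; apply: (@runs_seq _ _ _ _ _ _ 1 _ (reading j n a p p' c) o).
  have := @runs_read inp V (reading j n a p p' x) o (bl _ _ pV' xV) j 5 (2 + j).
  by have := bl _ _ pV' cV; rewrite /reading /c; case: (j) => /= ? /(_ _); apply.
apply: (@runs_seq _ _ _ _ _ _ 1 _ (reading j n a (p + 1) p' c) o).
  have := @runs_add inp V (reading j n a p p' c) o (bl _ _ pV' cV) (2 + j) (2 + j) 4.
  by have := bl _ _ pV1 cV; rewrite /reading /c; case: (j) => /= ? /(_ _); apply.
apply: runs_if; first exact: bl.
have -> : nth 0%N (reading j n a (p + 1) p' c) 5 = c by case: (j).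
(* The branch taken records the bit just read in the accumulator, so both cases merge into one
   recursive call. *)
rewrite (_ : (if _ then _ else _) = read_block j b k (rcons u c)); last by case: (c).
apply: IHb => // [|y yV]; first by lia.
rewrite cat_rcons addn1 addSnnS.
have := H y yV; congr (runs _ _ (k (_ ++ _)) _ _ _ _ _).
rewrite /mkseq /= addn0 -/c -[iota 1 b]/(iota (1 + 0) b) iotaDl -map_comp; congr (_ :: _).
by apply: eq_map => t /=; rewrite addnA addn1.
Qed.

Variables (b0 b1 L : nat) (F : seq bool -> seq bool -> seq bool).
Hypothesis sizeF : forall u v, size (F u v) = L.
Hypothesis l_gt0 : (0 < l)%N.

Definition blockwise_image (i : nat) : seq bool :=
  F (segment b0 (input inp 0) i) (segment b1 (input inp 1) i).

Lemma runs_block_step n a i o :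
  (l <= n)%N -> (n <= V)%N -> (a <= V)%N ->
  (i.+1 * b0 <= V)%N -> (i.+1 * b1 <= V)%N ->
  runs inp V (block_step b0 b1 F) (layout n a (i * b0) (i * b1) 0) o
    (b0 * 3 + (b1 * 3 + L.+1) + 3)
    (layout (n - l) (n - l - l.-1) (i.+1 * b0) (i.+1 * b1) 0)
    (o ++ blockwise_image i).
Proof.
move=> ln nV aV p0V p1V.
have blf n' a' : (n' <= V)%N -> (a' <= V)%N ->
    bounded V (layout n' a' (i.+1 * b0) (i.+1 * b1) 0).
  by move=> n'V a'V; exact: bounded_layout.
apply: (@runs_seq _ _ _ _ _ _ _ _ (layout n a (i.+1 * b0) (i.+1 * b1) 0)).
  have i1V : (i * b1 <= V)%N by lia.
  apply: (@runs_read_block false) => // [|y yV]; first by rewrite addnC -mulSn.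
  rewrite cat0s [(_ + b0)%N]addnC -mulSn.
  apply: (@runs_read_block true) => // [|z zV]; first by rewrite addnC -mulSn.
  rewrite cat0s [(_ + b1)%N]addnC -mulSn -(sizeF (segment b0 (input inp 0) i)
    (segment b1 (input inp 1) i)).
  by apply: runs_write_block; exact: bounded_layout.
have n1V : (n - l.-1 <= V)%N by lia.
have n2V : (n - l <= V)%N by lia.
have n3V : (n - l - l.-1 <= V)%N by lia.
apply: (@runs_seq _ _ _ _ _ _ 1 2 (layout (n - l.-1) a (i.+1 * b0) (i.+1 * b1) 0)).
  by apply: runs_sub; apply: blf.
apply: (@runs_seq _ _ _ _ _ _ 1 1 (layout (n - l) a (i.+1 * b0) (i.+1 * b1) 0)).
  have -> : (n - l = n - l.-1 - 1)%N by lia.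
  by apply: runs_sub; apply: blf => //=; lia.
by apply: runs_sub; apply: blf.
Qed.

(** Invariant: after [i] blocks the positions are [i * b0] and [i * b1], the output is the first [i]
    image blocks, and [n] is the length still to be processed. The 5 per block is the reset of
    register 5, three subtractions and the loop test. *)
Lemma runs_block_loop q n i :
  (n %/ l = q)%N -> (n <= V)%N -> ((i + q) * b0 <= V)%N -> ((i + q) * b1 <= V)%N ->
  exists n' a', runs inp V (While 1 (block_step b0 b1 F))
    (layout n (n - l.-1) (i * b0) (i * b1) 0) (concat L blockwise_image i)
    (q * (b0 * 3 + b1 * 3 + L + 5)).+1
    (layout n' a' ((i + q) * b0) ((i + q) * b1) 0)
    (concat L blockwise_image (i + q)).
Proof.
elim: q n i => [|q IHq] n i nq nV p0V p1V.
  have nl : (n < l)%N by rewrite ltnNge -divn_gt0 // nq.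
  exists n, (n - l.-1)%N; rewrite addn0; apply: runs_while_end; last by rewrite /=; lia.
  rewrite addn0 in p0V p1V; apply: bounded_layout => //; lia.
have ln : (l <= n)%N by rewrite -divn_gt0 // nq.
have p0V' : (i.+1 * b0 <= V)%N by nia.
have p1V' : (i.+1 * b1 <= V)%N by nia.
have nq' : ((n - l) %/ l = q)%N.
  by have := divnDr (n - l) (dvdnn l); rewrite subnK // nq divnn l_gt0 addn1 => -[].
have [|||n' [a' IH]] := IHq (n - l)%N i.+1 nq'; rewrite ?addSnnS //; first by lia.
exists n', a'; rewrite addSnnS in IH.
rewrite (_ : ((q.+1 * (b0 * 3 + b1 * 3 + L + 5)).+1 =
  (b0 * 3 + (b1 * 3 + L.+1) + 3 + (q * (b0 * 3 + b1 * 3 + L + 5)).+1).+1)%N); last by lia.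
apply: runs_while_step IH.
- by apply: bounded_layout => //; nia.
- by rewrite /=; lia.
- by rewrite concatS ?sizeF //; apply: runs_block_step => //; lia.
Qed.

End Blockwise.

(** The program is the same for all [n]; the loop itself performs the division by [l]. The 4 counts
    three initialising instructions and the failing last test. *)
Lemma exec_blockwise inp V l b0 b1 L F n : (0 < l)%N ->
  (forall u v, size (F u v) = L) -> (0 < V)%N -> (l.-1 <= V)%N -> (n <= V)%N ->
  (n %/ l * b0 <= V)%N -> (n %/ l * b1 <= V)%N ->
  exists s t m, [/\ exec inp (blockwise l b0 b1 F) (start n) s t m,
    out s = concat L (blockwise_image inp b0 b1 F) (n %/ l),
    (t <= (n %/ l * (b0 * 3 + b1 * 3 + L + 5) + 4) * (1 + 2 * bitlen V))%N &
    (m <= 7 * (3 + bitlen V))%N].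
Proof.
move=> l_gt0 sizeF V_gt0 lV nV p0V p1V.
have [n' [a' loop]] :=
  @runs_block_loop inp V l V_gt0 lV b0 b1 L F sizeF l_gt0 _ n 0 erefl nV p0V p1V.
have start_n : represents (start n) [:: n] [::].
  split=> // k; rewrite fsfun_withE.
  by rewrite fsfun0E; case: k => [|[|k]].
have all_runs : runs inp V (blockwise l b0 b1 F) [:: n] [::]
    (1 + (1 + (1 + (n %/ l * (b0 * 3 + b1 * 3 + L + 5)).+1)))
    (layout l n' a' (n %/ l * b0) (n %/ l * b1) 0)
    (concat L (blockwise_image inp b0 b1 F) (n %/ l)).
  apply: (@runs_seq _ _ _ _ _ _ _ _ [:: n; 0; 0; 0; 1]%N [::]).
    by apply: runs_const => //; rewrite /bounded /=; lia.
  apply: (@runs_seq _ _ _ _ _ _ _ _ (layout l n 0 0 0 0) [::]).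
    by apply: runs_const => //; rewrite /bounded /=; lia.
  apply: (@runs_seq _ _ _ _ _ _ _ _ (layout l n (n - l.-1) 0 0 0) [::]) loop.
  by apply: runs_sub => /=; rewrite /bounded /=; lia.
have [s [t [m [ex [_ os] tV mV]]]] := all_runs _ start_n.
exists s, t, m; split=> //.
by rewrite addn4 in tV *.
Qed.

(** * Asymptotic bounds *)

Local Open Scope ring_scope.

Section RealBounds.

Variable R : realType.

Lemma ln2_gt0 : 0 < ln 2 :> R.
Proof. by rewrite ln_gt0 // ltr1n. Qed.

Lemma log2_expn k : log2 (2 ^ k)%:R = k%:R :> R.
Proof.
by rewrite /log2 natrX lnXn // -[ln 2 *+ k]mulr_natl mulfK // gt_eqF // ln2_gt0.
Qed.

Lemma ler_log2 (x y : R) : 0 < x -> x <= y -> log2 x <= log2 y.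
Proof.
move=> x_gt0 xy; rewrite /log2 ler_pM2r ?invr_gt0 ?ln2_gt0 // ler_ln //.
by rewrite posrE (lt_le_trans x_gt0).
Qed.

Lemma log2M (x y : R) : 0 < x -> 0 < y -> log2 (x * y) = log2 x + log2 y.
Proof. by move=> x_gt0 y_gt0; rewrite /log2 lnM ?posrE // mulrDl. Qed.

Lemma log2Xn (x : R) k : 0 < x -> log2 (x ^+ k) = k%:R * log2 x.
Proof. by move=> x_gt0; rewrite /log2 lnXn // -[ln x *+ k]mulr_natl mulrA. Qed.

Lemma le1_log2 n : (1 < n)%N -> 1 <= log2 n%:R :> R.
Proof.
move=> n_gt1; rewrite -[leLHS](log2_expn 1) ler_log2 ?ltr0n // ler_nat.
exact: n_gt1.
Qed.

Lemma log2_eventually_ge (M : R) :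
  exists N, forall n, (N < n)%N -> M <= log2 n%:R.
Proof.
exists (2 ^ Num.bound `|M|)%N => n Nn.
apply: le_trans (_ : (Num.bound `|M|)%:R <= _).
  by apply: le_trans (ler_norm _) _; exact/ltW/archi_boundP.
by rewrite -[leLHS]log2_expn ler_log2 ?ltr0n ?expn_gt0 // ler_nat ltnW.
Qed.

(** With [u] the rounded-up logarithm of [n], the bit length is at most
    [D + 1 + u <= D + 2 + log n]. As [log n >= 1], the constant is absorbed into a multiple of
    [log n]. *)
Lemma bitlen_muln_le (D n : nat) : (1 < n)%N ->
  (bitlen (D * n))%:R <= (D + 3)%:R * log2 n%:R :> R.
Proof.
move=> n_gt1; have log_ge1 := le1_log2 n_gt1.
have n_gt0 : (0 < n)%N by exact: ltnW.
pose u := up_log 2 n.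
have bitlen_le : (bitlen (D * n) <= D + 1 + u)%N.
  apply: up_log_min => //; rewrite !expnD expn1.
  have := up_logP n (isT : 1 < 2)%N; have := ltn_expl D (isT : 1 < 2)%N.
  by rewrite -/u; nia.
have u_le : u%:R <= 1 + log2 n%:R :> R.
  have u_gt0 : (0 < u)%N by rewrite up_log_gt0.
  have /andP[u_lt _] := up_log_bounds (isT : 1 < 2)%N n_gt1.
  rewrite -(prednK u_gt0) -[u.-1.+1]add1n natrD lerD2l -log2_expn.
  by rewrite ler_log2 ?ltr0n ?expn_gt0 // ler_nat ltnW.
apply: le_trans (_ : (D + 1 + u)%:R <= _); first by rewrite ler_nat.
rewrite !natrD; have := ler0n R D; nra.
Qed.

Lemma computes_blockwise (l b0 b1 L : nat) F :
  (0 < l)%N -> (forall u v, size (F u v) = L) ->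
  exists A K : R, forall n inp, (1 < n)%N ->
    computes_within (blockwise l b0 b1 F) n inp
      (concat L (blockwise_image inp b0 b1 F) (n %/ l))
      (A * n%:R * log2 n%:R) (K * log2 n%:R).
Proof.
move=> l_gt0 sizeF.
(* [D * n] bounds all register contents: the remaining length, [l - 1] and both reading
   positions. *)
pose D := (l + b0 + b1)%N; pose X := (b0 * 3 + b1 * 3 + L + 5)%N.
exists ((X + 4)%:R * (2 * D + 7)%:R), (7 * (D + 6)%:R) => n inp n_gt1.
have log_ge1 := le1_log2 n_gt1.
have ql : (n %/ l <= n)%N by exact: leq_div.
have [|||||s [t [m [ex os tV mV]]]] := @exec_blockwise inp (D * n) l b0 b1 L F n
  l_gt0 sizeF;
  try by rewrite /D; nia.
have B := bitlen_muln_le D n_gt1.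
exists s, t, m; split=> //.
  apply: le_trans (_ : ((n * (X + 4)) * (1 + 2 * bitlen (D * n)))%:R <= _).
    by rewrite ler_nat; apply: leq_trans tV _; rewrite leq_mul2r -/X; apply/orP; right; nia.
  have le_b : (1 + 2 * bitlen (D * n))%:R <= (2 * D + 7)%:R * log2 n%:R :> R.
    by move: B; rewrite ?(natrM, natrD); lra.
  rewrite natrM; apply: le_trans (ler_wpM2l (ler0n _ _) le_b) _.
  by rewrite natrM le_eqVlt; apply/orP; left; apply/eqP; ring.
apply: le_trans (_ : (7 * (3 + bitlen (D * n)))%:R <= _); first by rewrite ler_nat.
by move: B; rewrite ?(natrM, natrD); lra.
Qed.

(** * The weight [w] and the rate of one block *)

(** [w] maximises the binomial probability [t]. Comparing [t w] with its two neighbours through the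
    ratio of consecutive terms puts [w] within 1 of [p * l]; the [l + 1] terms sum to 1, so the
    largest is at least [1 / (l + 1)]. *)
Lemma binomial_mode (p : R) (l : nat) : 0 < p < 1 -> exists w : nat,
  [/\ (w <= l)%N, p * l%:R <= w%:R + 1, w%:R <= p * l%:R + 1 &
      1 <= l.+1%:R * ('C(l, w)%:R * p ^+ w * (1 - p) ^+ (l - w))].
Proof.
move=> /andP[p_gt0 p_lt1].
have q_gt0 : 0 < 1 - p by rewrite subr_gt0.
pose t i : R := 'C(l, i)%:R * p ^+ i * (1 - p) ^+ (l - i).
have t_gt0 i : (i <= l)%N -> 0 < t i.
  by move=> il; rewrite !mulr_gt0 ?exprn_gt0 // ltr0n bin_gt0.
have ratio i : (i < l)%N ->
    i.+1%:R * (1 - p) * t i.+1 = (l - i)%:R * p * t i.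
  move=> il; rewrite /t exprS (_ : l - i = (l - i.+1).+1)%N; last by lia.
  have /(congr1 (fun n => n%:R : R)) := mul_bin_left l i.
  rewrite !natrM (_ : l - i = (l - i.+1).+1)%N; last by lia.
  move=> eq_bin; rewrite [in RHS]exprS.
  transitivity (i.+1%:R * 'C(l, i.+1)%:R * ((1 - p) * p * p ^+ i * (1 - p) ^+ (l - i.+1))).
    by ring.
  by rewrite eq_bin; ring.
have [w _ w_max] : exists2 w : 'I_l.+1, true & forall i : 'I_l.+1, t i <= t w.
  by case: (arg_maxP (fun i : 'I_l.+1 => t i) (isT : xpredT ord0)) => w _ w_max;
    exists w => // i; exact: w_max.
have wl : (w <= l)%N by rewrite -ltnS.
exists w; split=> //.
- case: (ltnP w l) => [wl'|lw]; last first.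
    have -> : (w : nat) = l by lia.
    have := ler0n R l; nra.
  have := w_max (Ordinal (wl' : (w.+1 < l.+1)%N)) => /= le_t.
  have : (l - w)%:R * p * t w <= w.+1%:R * (1 - p) * t w.
    by rewrite -ratio // ler_wpM2l // mulr_ge0 // ltW.
  by rewrite ler_pM2r ?t_gt0 // natrB // -natr1; lra.
- case: (posnP w) => [->|w_gt0]; first by have := ler0n R l; nra.
  have wl' : (w.-1 < l.+1)%N by lia.
  have := w_max (Ordinal wl') => /= le_t.
  have : w.-1.+1%:R * (1 - p) * t w.-1.+1 <= (l - w.-1)%:R * p * t w.
    by rewrite ratio; [rewrite ler_wpM2l // mulr_ge0 // ltW | lia].
  rewrite prednK // ler_pM2r ?t_gt0 // natrB; last by lia.
  have -> : w%:R = w.-1%:R + 1 :> R by rewrite natr1 prednK.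
  by lra.
- have sum_t : \sum_(i < l.+1) t i = 1.
    rewrite -[RHS](expr1n _ l) -{1}(subrK p 1) exprDn; apply: eq_bigr => i _.
    by rewrite /t -mulr_natl; ring.
  rewrite -[leLHS]sum_t; apply: (@le_trans _ _ (\sum_(i < l.+1) t w)).
    by apply: ler_sum => i _; exact: w_max.
  by rewrite sumr_const card_ord -[leLHS]mulr_natl.
Qed.

Lemma linear_le_expn2 (eps b : R) : 0 < eps -> 0 <= b ->
  exists m : nat, b + 2 * m%:R <= eps * (2 ^ m)%:R.
Proof.
move=> eps_gt0 b_ge0; pose c := (b + 4) / eps.
have c_ge0 : 0 <= c by apply: divr_ge0; lra.
pose t := Num.bound c.
(* Splitting [2^(2t)] as [2^t * 2^t], one factor is at least [c = (b + 4) / eps] and the other at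
   least [t + 1]. *)
exists (2 * t)%N; rewrite mul2n -addnn expnD natrM natrD.
have t_lt : t.+1%:R <= (2 ^ t)%:R :> R by rewrite ler_nat ltn_expl.
have c_lt : c < t%:R := archi_boundP c_ge0.
have b_eq : b + 4 = eps * c by rewrite /c mulrC divfK // gt_eqF.
rewrite -natr1 in t_lt; have t_ge0 := ler0n R t.
apply: le_trans (_ : (b + 4) * (t%:R + 1) <= _); first by nra.
rewrite b_eq -mulrA ler_wpM2l ?(ltW eps_gt0) // ler_pM //; lra.
Qed.

Lemma block_code_of_rate (eps p : R) : 0 < eps -> 0 < p < 1 ->
  exists l k1 k2 : nat, [/\ (0 < l)%N,
    inhabited (wom_code l (k1.-tuple bool) (k2.-tuple bool)) &
    entropy p + 1 - p - eps <= (k1%:R + k2%:R) / l%:R].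
Proof.
move=> eps_gt0 p01; have /andP[p_gt0 p_lt1] := p01.
have q_gt0 : 0 < 1 - p by rewrite subr_gt0.
have log_le0 (x : R) : 0 < x -> x < 1 -> log2 x <= 0.
  move=> x_gt0 x_lt1; have <- : log2 1 = 0 :> R by rewrite /log2 ln1 mul0r.
  by rewrite ler_log2 // ltW.
have a_le0 := log_le0 _ p_gt0 p_lt1.
have b_le0 : log2 (1 - p) <= 0 by apply: log_le0 => //; lra.
(* The left side is the total loss in [k1 + k2]: [m + 2] from rounding [k1] and from [log (l + 1)],
   [m + 1] from [u], 1 from [w <= p * l + 1], and the two logarithms from replacing [w] by [p * l]
   in the entropy. *)
have [m le_m] : exists m : nat,
    4 - log2 p - log2 (1 - p) + 2 * m%:R <= eps * (2 ^ m)%:R.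
  by apply: linear_le_expn2 => //; lra.
pose l := (2 ^ m)%N.
have l_gt0 : (0 < l)%N by rewrite expn_gt0.
have lR_gt0 : 0 < l%:R :> R by rewrite ltr0n.
have [w [wl w_ge w_le mode]] := binomial_mode l p01.
have C_gt0 : (0 < 'C(l, w))%N by rewrite bin_gt0.
(* Here [u = m + 1], so that [2 ^ u = 2 * l] exactly. *)
exists l, (trunc_log 2 'C(l, w)), (l - w - m.+1)%N; split=> //.
  by apply: block_code_exists => //; [exact: trunc_logP | rewrite expnS].
set k1 := trunc_log _ _; set k2 := (_ - _ - _)%N.
have k1_ge : log2 'C(l, w)%:R <= k1%:R + 1 :> R.
  rewrite natr1 -[leRHS]log2_expn ler_log2 ?ltr0n // ler_nat ltnW //.
  exact: trunc_log_ltn.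
have log_l : log2 l.+1%:R <= m%:R + 1 :> R.
  rewrite natr1 -[leRHS]log2_expn ler_log2 ?ltr0n // ler_nat expnS.
  by rewrite -/l; lia.
have k2_ge : l%:R - w%:R - (m%:R + 1) <= k2%:R :> R.
  by rewrite natr1 -natrB // lerBlDr -natrD ler_nat addnC -leq_subLR.
have k1_ge' : - (w%:R * log2 p) - (l%:R - w%:R) * log2 (1 - p) <= k1%:R + m%:R + 2.
  have := ler_log2 ltr01 mode; rewrite {1}/log2 ln1 mul0r.
  rewrite !log2M ?mulr_gt0 ?exprn_gt0 ?ltr0n // !log2Xn // natrB //; lra.
rewrite ler_pdivlMr // /entropy.
(* Both logarithms are nonpositive; these two products are the nonlinear facts that reduce the goal
   to linear arithmetic. *)
have w_ge' : 0 <= (w%:R - (p * l%:R - 1)) * - log2 p.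
  by apply: mulr_ge0; lra.
have w_le' : 0 <= (p * l%:R + 1 - w%:R) * - log2 (1 - p).
  by apply: mulr_ge0; lra.
by move: le_m; rewrite -/l; lra.
Qed.

End RealBounds.

(** * Length of the repeated code and choice of the constants *)

Local Open Scope classical_set_scope.
Local Open Scope ring_scope.

(** The difference equals [-(n %% l) / n], of absolute value at most [l / n]. *)
Lemma multiple_below_cvg (R : realType) (l : nat) : (0 < l)%N ->
  (n %/ l * l)%:R / n%:R - 1 @[n --> \oo] --> (0 : R).
Proof.
move=> l_gt0; apply/cvgr0Pnorm_le => e e_gt0.
exists (Num.bound (l%:R / e)).+1 => // n /= n_gt.
have n_gt0 : 0 < n%:R :> R by rewrite ltr0n; apply: leq_trans n_gt.
have -> : (n %/ l * l)%:R / n%:R - 1 = - ((n %% l)%:R / n%:R) :> R.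
  have n_neq0 : n%:R != 0 :> R by rewrite gt_eqF.
  apply: (mulIf n_neq0); rewrite mulrBl mulNr !divfK // mul1r {2}(divn_eq n l).
  by rewrite natrD opprD addrA subrr add0r.
rewrite normrN ger0_norm ?divr_ge0 // ler_pdivrMr //.
apply: le_trans (_ : l%:R <= _); first by rewrite ler_nat ltnW // ltn_mod.
rewrite -ler_pdivrMl // mulrC; apply: le_trans (_ : (Num.bound (l%:R / e))%:R <= _).
  by apply/ltW/archi_boundP; rewrite divr_ge0 ?(ltW e_gt0).
by rewrite ler_nat ltnW.
Qed.

Theorem theorem1p1 (R : realType) :
  exists qE qD : {poly R},
  forall eps p c : R, 0 < eps -> 0 < p < 1 -> 0 < c ->
  exists (N : nat) (len M1 M2 : nat -> nat) (o : nat -> R)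
    (PE1 PE2 PD1 PD2 : prog) (K : R),
    o n @[n --> \oo] --> (0 : R) /\
    forall n : nat, (N < n)%N ->
      (len n)%:R = n%:R * (1 + o n) /\
      exists C : wom_code (len n) 'I_(M1 n) 'I_(M2 n),
        entropy p + 1 - p - eps <= rate R C /\
        let timeE := n%:R `^ (c + 1) * qE.[c * log2 n%:R] in
        let timeD := n%:R * qD.[c * log2 n%:R] in
        let memory := K * log2 n%:R in
        forall (x1 : 'I_(M1 n)) (x2 : 'I_(M2 n)),
          let y1 := E1 C x1 in
          let y2 := E2 C y1 x2 in
          [/\ computes_within PE1 n [:: msg_bits x1] y1 timeE memory,
              computes_within PE2 n [:: tval y1; msg_bits x2] y2 timeE memory,
              computes_within PD1 n [:: tval y1] (msg_bits x1) timeD memory &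
              computes_within PD2 n [:: tval y2] (msg_bits x2) timeD memory].
Proof.
(* All running times will be at most [A * n * log n] with [A] depending on [eps] and [p] only. Since
   [(c * log n)^2 >= A * log n] once [log n >= A / c^2], the fixed polynomial absorbs [A] at the
   price of a larger [N]. *)
exists ('X^2), ('X^2) => eps p c eps_gt0 p01 c_gt0.
have [l [k1 [k2 [l_gt0 [C] rate_ge]]]] := block_code_of_rate eps_gt0 p01.
(* For a program with a single input the second block length is 0, so the second segment is always
   empty. *)
pose F1 u (_ : seq bool) := block_E1 C u.
pose F2 u v := block_E2 C u v.
pose G1 u (_ : seq bool) := block_D1 C u.
pose G2 u (_ : seq bool) := block_D2 C u.
have [A1 [K1 run1]] := @computes_blockwise R l k1 0 l F1 l_gt0 (fun _ _ => size_tuple _).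
have [A2 [K2 run2]] := @computes_blockwise R l l k2 l F2 l_gt0 (fun _ _ => size_tuple _).
have [A3 [K3 run3]] := @computes_blockwise R l l 0 k1 G1 l_gt0 (fun _ _ => size_tuple _).
have [A4 [K4 run4]] := @computes_blockwise R l l 0 k2 G2 l_gt0 (fun _ _ => size_tuple _).
pose A := \big[Num.max/0]_(a <- [:: A1; A2; A3; A4]) a.
pose K := \big[Num.max/0]_(k <- [:: K1; K2; K3; K4]) k.
have [N0 log_ge] := log2_eventually_ge (A / c ^+ 2).
(* [n > l] guarantees at least one block, and [n > 1] gives [log n >= 1]. *)
exists (maxn N0 (maxn l 1)), (fun n => n %/ l * l)%N,
  (fun n => 2 ^ (n %/ l * k1))%N, (fun n => 2 ^ (n %/ l * k2))%N,
  (fun n => (n %/ l * l)%:R / n%:R - 1),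
  (blockwise l k1 0 F1), (blockwise l l k2 F2), (blockwise l l 0 G1),
  (blockwise l l 0 G2), K.
split=> [|n]; first exact: multiple_below_cvg.
rewrite !gtn_max => /and3P[Nn ln n_gt1].
have n_gt0 : (0 < n)%N by exact: ltnW.
have nR_gt0 : 0 < n%:R :> R by rewrite ltr0n.
have log_ge1 := le1_log2 R n_gt1.
have log_gt0 : 0 < log2 n%:R :> R by exact: lt_le_trans log_ge1.
split; first by rewrite addrC subrK mulrC divfK // gt_eqF.
pose q := (n %/ l)%N.
have q_gt0 : (0 < q)%N by rewrite divn_gt0 // ltnW.
exists (repeated_code q C); split.
  (* The factor [q] cancels: repetition preserves the rate of the block code. *)
  rewrite /rate !card_ord !log2_expn !natrM -mulrDr invfM mulrACA.
  by rewrite divff ?mul1r // pnatr_eq0 -lt0n.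
have ge_A a : a \in [:: A1; A2; A3; A4] -> a <= A by move=> aA; exact: le_bigmax_seq.
have ge_K k : k \in [:: K1; K2; K3; K4] -> k <= K by move=> kK; exact: le_bigmax_seq.
move=> timeE timeD memory x1 x2 y1 y2.
have timeD_ge a : a <= A -> a * n%:R * log2 n%:R <= timeD.
  move=> aA; rewrite /timeD hornerXn.
  have -> : n%:R * (c * log2 n%:R) ^+ 2 = log2 n%:R * c ^+ 2 * n%:R * log2 n%:R by ring.
  rewrite !ler_pM2r // (le_trans aA) // -ler_pdivrMr ?exprn_gt0 //.
  exact: log_ge.
have timeDE : timeD <= timeE.
  rewrite /timeD /timeE !hornerXn ler_wpM2r ?sqr_ge0 //.
  have n_ge1 : 1 <= n%:R :> R by rewrite ler1n.
  have c1_ge1 : 1 <= c + 1 by rewrite lerDr ltW.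
  by have := ler_powR n_ge1 c1_ge1; rewrite powRr1 ?ler0n.
have within P inp res a k : a <= A -> k <= K ->
    computes_within P n inp res (a * n%:R * log2 n%:R) (k * log2 n%:R) ->
    computes_within P n inp res timeD memory.
  move=> aA kK [s [t [m [ex os tT mS]]]]; exists s, t, m; split=> //.
    exact: le_trans tT (timeD_ge _ aA).
  by apply: le_trans mS _; rewrite ler_wpM2r ?(ltW log_gt0).
have withinE P inp res : computes_within P n inp res timeD memory ->
    computes_within P n inp res timeE memory.
  by move=> [s [t [m [ex os tT mS]]]]; exists s, t, m; split=> //;
    exact: le_trans tT timeDE.
split.
- apply: withinE; apply: (within _ _ _ A1 K1); rewrite ?ge_A ?ge_K ?inE ?eqxx ?orbT //.
  rewrite (repeated_E1E C x1); exact: run1.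
- apply: withinE; apply: (within _ _ _ A2 K2); rewrite ?ge_A ?ge_K ?inE ?eqxx ?orbT //.
  rewrite (repeated_E2E C y1 x2); exact: run2.
- apply: (within _ _ _ A3 K3); rewrite ?ge_A ?ge_K ?inE ?eqxx ?orbT //.
  (* The message is rewritten as the decoding of its codeword, which is the output the program is
     known to produce. *)
  rewrite -[X in computes_within _ _ _ X](seq_D1K C (size_msg_bits x1)).
  rewrite -(repeated_E1E C x1); exact: run3.
- apply: (within _ _ _ A4 K4); rewrite ?ge_A ?ge_K ?inE ?eqxx ?orbT //.
  rewrite -[X in computes_within _ _ _ X](seq_D2K C (msg_bits x1) (size_msg_bits x2)).
  rewrite -(repeated_E1E C x1) -(repeated_E2E C _ x2); exact: run4.
Qed.
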